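(* Let $n\geq 2$ be an integer and let $X$ be an $n$-Urysohn $n$-H-closed topological space. Then $|X|\leq 2^{\,n\text{-}U\psi(X)}$ (hence $|X|\leq 2^{\chi(X)}$).
   Context: Throughout $n\ge 2$ is an integer. The Hausdorff number $H(X)$ (resp. Urysohn number $U(X)$) of a space $X$ is the least cardinal $\kappa$ such that for every $A\subseteq X$ with $|A|\geq\kappa$ there exist open neighbourhoods $U_a$ of $a$ ($a\in A$) with $\bigcap_{a\in A}U_a=\emptyset$ (resp. $\bigcap_{a\in A}\overline{U_a}=\emptyset$). $X$ is $n$-Hausdorff if $H(X)\leq n$, and $n$-Urysohn if $U(X)\leq n$. An $n$-Hausdorff space is called $n$-H-closed if it is closed in every $n$-Hausdorff space in which it is embedded. For an $n$-Urysohn space $X$, the $n$-Urysohn pseudocharacter $n\text{-}U\psi(X)$ is the minimum infinite cardinal $\kappa$ such that for each point $x\in X$ there is a collection $\{V(\alpha,x):\alpha<\kappa\}$ of open neighbourhoods of $x$ such that whenever $x_1,\dots,x_n$ are different points of $X$ there exist $\alpha_1,\dots,\alpha_n<\kappa$ with $\overline{V(\alpha_1,x_1)}\cap\dots\cap\overline{V(\alpha_n,x_n)}=\emptyset$. $\chi(X)$ is the character of $X$, multiplied by $\omega$ (so it is always infinite). *)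

(* Defs.v *)
From mathcomp Require Import all_boot boolp classical_sets functions cardinality.
From mathcomp Require Import topology.

Set Implicit Arguments.
Unset Strict Implicit.
Unset Printing Implicit Defensive.

Local Open Scope classical_set_scope.
Local Open Scope card_scope.

(* Cardinals are represented by types, a type [K] standing for the cardinality
   of [[set: K]]; they are compared with [#<=], and [2 ^ K] is [set K]. *)

Definition is_card_min (P : Type -> Prop) (K : Type) : Prop :=
  P K /\ forall K' : Type, P K' -> [set: K] #<= [set: K'].

(* A type whose cardinality is the least one satisfying [P]; by [card_minP] the
   default value is only used when no type satisfies [P]. *)
Definition card_min (P : Type -> Prop) : Type :=
  if pselect (exists K, is_card_min P K) is left e then sval (cid e) else void.

Lemma card_leT_inj (K L : Type) (f : K -> L) :
  injective f -> [set: K] #<= [set: L].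
Proof.
move=> fI; have [g] : $|{injfun [set: K] >-> [set: L]}|.
  by apply/injfunPex; exists f => // x y _ _; exact: fI.
exact: (inj_card_le g).
Qed.

(* By Zorn's lemma applied to the sets of choice functions on which every
   projection is injective. The class of all types satisfying some [P] is too
   large to serve as the index type [I] here (universe constraints), whence the
   detour through subsets of one type in [is_card_min_exists]. *)
Lemma card_min_family (I : Type) (F_ : I -> Type) (i0 : I) :
  exists i, forall j, [set: F_ i] #<= [set: F_ j].
Proof.
pose D := forall i : I, F_ i.
pose Q (F : set D) := forall (i : I) (x y : D), F x -> F y -> x i = y i -> x = y.
have [F [QF maxF]] : exists A, Q A /\ forall B, A `<` B -> ~ Q B.
  apply: Zorn_bigcup => G GQ totG i x y [A GA Ax] [B GB By] xy.
  have [AB|BA] := totG _ _ GA GB.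
  - exact: (GQ B GB i) (AB _ Ax) By xy.
  - exact: (GQ A GA i) Ax (BA _ By) xy.
have [[i surj]|] := pselect (exists i : I, forall k, exists2 x, F x & x i = k).
  exists i => j.
  have /choice[g gP] : forall k : F_ i, exists x : D, F x /\ x i = k.
    by move=> k; have [x Fx xk] := surj k; exists x.
  apply: (@card_leT_inj _ _ (fun k => g k j)) => k l.
  move=> /(QF j _ _ (proj1 (gP k)) (proj1 (gP l))) gkl.
  by rewrite -(proj2 (gP k)) -(proj2 (gP l)) gkl.
move=> nsurj; exfalso.
have new (i : I) : {k : F_ i | forall x, F x -> x i <> k}.
  apply: cid; apply: contrapT => none; apply: nsurj; exists i => k.
  apply: contrapT => nk; apply: none; exists k => x Fx xk.
  by apply: nk; exists x.
pose z : D := fun i => sval (new i).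
have zN x i : F x -> x i <> z i by move=> Fx; exact: (svalP (new i)).
apply: (maxF (F `|` [set z])).
  split; first exact: subsetUl.
  by move=> /(_ z (or_intror erefl)) Fz; exact: (zN z i0 Fz).
move=> i x y [Fx|->] [Fy|->] //; first exact: QF.
- by move=> /(zN _ _ Fx).
- by move=> /esym /(zN _ _ Fy).
Qed.

Lemma card_le_total (K L : Type) :
  [set: K] #<= [set: L] \/ [set: L] #<= [set: K].
Proof.
have [[] KL] := card_min_family (fun b : bool => if b then K else L) true.
- by left; exact: (KL false).
- by right; exact: (KL true).
Qed.

Lemma is_card_min_exists (P : Type -> Prop) :
  (exists K, P K) -> exists K, is_card_min P K.
Proof.
move=> [K0 PK0]; pose Q (S : set K0) := exists K, P K /\ S #= [set: K].
have QT : Q setT by exists K0; split=> //; exact: card_eqxx.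
have [[S [K [PK SK]]] /= minS] :=
  card_min_family (fun S : {S | Q S} => set_type (sval S)) (exist _ setT QT).
exists K; split=> // K' PK'.
have leS (S' : set K0) : Q S' -> [set: K] #<= S'.
  move=> QS'; have := minS (exist _ S' QS') => /=.
  rewrite (card_le_eql (card_setT S)) (card_le_eqr (card_setT S')).
  by rewrite (card_le_eql SK).
have [KK'|K'K0] := card_le_total K0 K'; first exact: card_le_trans (leS _ QT) KK'.
have [f _ fI] : exists2 f : K' -> K0, True & injective f.
  have /card_leP[g] := K'K0.
  exists (fun x => set_val (g (SigSub (mem_set (I : [set: K'] x))))) => // x y.
  by move=> /val_inj/(@inj _ _ _ g)-/(_ (in_setT _) (in_setT _)) /(congr1 val).
have fE : range f #= [set: K'] by apply: inj_card_eq => x y _ _; exact: fI.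
by rewrite -(card_le_eqr fE); apply: leS; exists K'.
Qed.

Lemma card_minP (P : Type -> Prop) :
  (exists K, P K) -> is_card_min P (card_min P).
Proof.
move=> /is_card_min_exists exK; rewrite /card_min.
by case: pselect => // e; exact: (svalP (cid e)).
Qed.

Definition hausdorff_number (X : topologicalType) : Type :=
  card_min (fun K => forall A : set X, [set: K] #<= A ->
    exists2 U : X -> set X, forall a, A a -> open_nbhs a (U a) &
      \bigcap_(a in A) U a = set0).

Definition urysohn_number (X : topologicalType) : Type :=
  card_min (fun K => forall A : set X, [set: K] #<= A ->
    exists2 U : X -> set X, forall a, A a -> open_nbhs a (U a) &
      \bigcap_(a in A) closure (U a) = set0).

Definition n_hausdorff (n : nat) (X : topologicalType) : Prop :=
  [set: hausdorff_number X] #<= `I_n.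

Definition n_urysohn (n : nat) (X : topologicalType) : Prop :=
  [set: urysohn_number X] #<= `I_n.

Definition embedding (X Y : topologicalType) (f : X -> Y) : Prop :=
  injective f /\ @open X = @open (initial_topology f).

Definition n_H_closed (n : nat) (X : topologicalType) : Prop :=
  n_hausdorff n X /\
  forall (Y : topologicalType) (f : X -> Y),
    n_hausdorff n Y -> embedding f -> closed (range f).

Definition n_urysohn_pseudocharacter (n : nat) (X : topologicalType) : Type :=
  card_min (fun K => infinite_set [set: K] /\
    exists V : K -> X -> set X,
      (forall k x, open_nbhs x (V k x)) /\
      forall x : 'I_n -> X, injective x ->
        exists k : 'I_n -> K, \bigcap_i closure (V (k i) (x i)) = set0).

Definition local_base (X : topologicalType) (x : X) (B : set (set X)) : Prop :=
  B `<=` open_nbhs x /\ forall U, nbhs x U -> exists2 V, B V & V `<=` U.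

Definition character_at (X : topologicalType) (x : X) : Type :=
  card_min (fun K => exists2 B, local_base x B & B #= [set: K]).

(* The supremum over [x] of the [character_at x], multiplied by [omega]. *)
Definition character (X : topologicalType) : Type :=
  (card_min (fun K => forall x : X, [set: character_at x] #<= [set: K]) * nat)%type.

(* Main.v *)
Require Import Defs.
From HB Require Import structures.
From mathcomp Require Import all_boot boolp classical_sets functions cardinality.
From mathcomp Require Import topology.

(** Let [K] be an infinite type indexing neighbourhoods [V k x] that witness the
    n-Urysohn pseudocharacter of [X].

    All that is used of n-H-closedness is [n_H_closed_cluster]: a proper filter
    [F] with a base of open sets has at least [n-1] cluster points. Otherwise
    add to [X] one point with the members of [F] as its deleted neighbourhoods.
    Together with [n-1] points of [X] the new point can still be separated,
    since one of them is not a cluster point, so the extension is n-Hausdorff;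
    but [X] is not closed in it. Two consequences are drawn.
    - [n_H_closed_dense_finite]: a choice of open neighbourhoods of all points
      outside a set with fewer than [n-1] elements has a finite subfamily
      whose closures cover [X].
    - [centered_exists]: every point [p] belongs to a set [s] of [n-1] points
      such that any open neighbourhoods of its points have a common point
      ([centered]). If [x] is not in [s], the pseudocharacter condition applied
      to [x] and the points of [s] then yields [k] such that the closure of
      [V k x] misses [p] ([urysohn_pseudobase_separation]).

    A set [A] of size at most [2 ^ K] is now closed off under two kinds of
    operations. For a family [a] of points indexed by [seq K], fewer than [n]
    points [x] are such that each [a l] lies in the closure of [V k x] for all
    [k] in [l]; these are added. It follows that a point [x] outside [A] has a
    neighbourhood, a finite intersection of sets [V k x], whose closure misses
    [A]. Moreover, whenever finitely many sets [closure (V k x)], with [x] in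
    [A], do not cover [X], a point outside their union is added.

    Then [A] is all of [X]. Suppose that [p] is not in [A], and let [s] be as
    above. To each [x] in [A] but not in [s] associate [V k x] whose closure
    misses [p], and to each [x] outside [A] a neighbourhood whose closure misses
    [A]. As [p] is not in [A], only the at most [n-2] points of [A] that lie in
    [s] are left out, so finitely many of these closures cover [X]. Those around
    points of [A] must already cover [A], though not [p], and this contradicts
    the second closure property.

    The bound on [A] needs [seq K] to be no larger than [K], hence
    [infinite_pairing]; elements of [A] are then values of well-founded trees
    with branches indexed by [seq K], and such a tree is determined by a subset
    of a type no larger than [K]. Finally, local bases indexed by the character
    are a family [V] as above because [X] is n-Urysohn, so the second bound
    follows from the first. *)

Set Implicit Arguments.
Unset Strict Implicit.
Unset Printing Implicit Defensive.

Local Open Scope classical_set_scope.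
Local Open Scope card_scope.

(** * An infinite cardinal is equal to its square *)

Lemma card_le_fun (S T : Type) (t0 : T) (A : set S) (B : set T) :
  A #<= B -> exists2 f : S -> T, (forall x, A x -> B (f x)) &
    forall x y, A x -> A y -> f x = f y -> x = y.
Proof.
move=> /card_leP[g].
pose f x := if pselect (A x) is left Ax
  then set_val (g (SigSub (mem_set Ax))) else t0.
exists f => [x Ax|x y Ax Ay]; rewrite /f; case: pselect => // Ax'.
  exact: set_valP.
case: pselect => // Ay' /val_inj.
by move=> /(@inj _ _ _ g)-/(_ (in_setT _) (in_setT _)) /(congr1 val).
Qed.

Lemma fun_card_le (S T : Type) (A : set S) (B : set T) (f : S -> T) :
  (forall x, A x -> B (f x)) ->
  (forall x y, A x -> A y -> f x = f y -> x = y) -> A #<= B.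
Proof.
move=> fAB fI; have [g] : $|{injfun A >-> B}|.
  by apply/injfunPex; exists f => // x y /set_mem Ax /set_mem Ay; exact: fI.
exact: (inj_card_le g).
Qed.

Lemma card_le_fun_type (A B : Type) : [set: A] #<= [set: B] ->
  exists f : A -> B, injective f.
Proof.
have [[b]|nB] := pselect (inhabited B).
  by move=> /(card_le_fun b)[f _ fI]; exists f => x y; apply: fI.
move=> /card_leP[g]; suff nA : A -> False.
  by exists (fun a => match nA a with end) => x; case: (nA x).
move=> a; apply: nB; constructor.
exact: (set_val (g (SigSub (mem_set (I : [set: A] a))))).
Qed.

Section Pairing.
Variable K : Type.
Implicit Types (G : set (K * K * K)) (x y z : K).

(** The set [D] such that [G] is meant to be the graph of a function on
    [D * D], read off from the diagonal. *)
Definition square G : set K := [set x | exists z, G (x, x, z)].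

(** [G] is the graph of an injective function from [D * D] to [D], where [D] is
    [square G]. *)
Definition pairing_graph G : Prop :=
  [/\ forall x y z, G (x, y, z) -> [/\ square G x, square G y & square G z],
      forall x y, square G x -> square G y -> exists z, G (x, y, z),
      forall x y z z', G (x, y, z) -> G (x, y, z') -> z = z' &
      forall x y x' y' z, G (x, y, z) -> G (x', y', z) -> x = x' /\ y = y'].

Lemma squareS G G' : G `<=` G' -> square G `<=` square G'.
Proof. by move=> GG' x [z /GG' Gz]; exists z. Qed.

Lemma pairing_graph_bigcup (F : set (set (K * K * K))) :
  F !=set0 -> F `<=` pairing_graph -> total_on F subset ->
  pairing_graph (\bigcup_(G in F) G).
Proof.
move=> [G0 FG0] FP totF.
have sub G : F G -> G `<=` \bigcup_(G in F) G by move=> FG t Gt; exists G.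
have common t t' : (\bigcup_(G in F) G) t -> (\bigcup_(G in F) G) t' ->
    exists G, [/\ F G, G t & G t'].
  move=> [G FG Gt] [G' FG' Gt']; have [GG'|G'G] := totF _ _ FG FG'.
    by exists G'; split=> //; exact: GG'.
  by exists G; split=> //; exact: G'G.
split.
- move=> x y z [G FG Gt]; have [/(_ _ _ _ Gt)[Gx Gy Gz] _ _ _] := FP _ FG.
  by split; exact: squareS (sub _ FG) _ _.
- move=> x y [z Gz] [z' Gz']; have [G [FG Gx Gy]] := common _ _ Gz Gz'.
  have [_ GP _ _] := FP _ FG.
  have [w Gw] := GP x y (ex_intro _ z Gx) (ex_intro _ z' Gy).
  by exists w; exact: (sub _ FG).
- move=> x y z z' Gz Gz'; have [G [FG Gx Gy]] := common _ _ Gz Gz'.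
  by have [_ _ GP _] := FP _ FG; exact: GP Gx Gy.
- move=> x y x' y' z Gz Gz'; have [G [FG Gx Gy]] := common _ _ Gz Gz'.
  by have [_ _ _ GP] := FP _ FG; exact: GP Gx Gy.
Qed.

(** The function with graph [G], extended arbitrarily outside [D * D]. *)
Lemma pairing_graph_fun G (D := square G) :
  pairing_graph G -> D !=set0 ->
  exists f : K * K -> K,
    [/\ forall x y, D x -> D y -> G (x, y, f (x, y)),
        forall x y, D x -> D y -> D (f (x, y)) &
        forall x y x' y', D x -> D y -> D x' -> D y' ->
          f (x, y) = f (x', y') -> x = x' /\ y = y'].
Proof.
move=> [G1 G2 G3 G4] [c0 Dc0].
have /choice[f fP] : forall t : K * K, exists z,
    D t.1 -> D t.2 -> G (t.1, t.2, z).
  move=> [x y] /=; have [[Dx Dy]|nD] := pselect (D x /\ D y).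
    by have [z Gz] := G2 _ _ Dx Dy; exists z.
  by exists c0 => Dx Dy; case: nD.
exists f; split=> [x y|x y Dx Dy|x y x' y' Dx Dy Dx' Dy' e].
- exact: (fP (x, y)).
- by have [] := G1 _ _ _ (fP (x, y) Dx Dy).
- apply: (G4 _ _ _ _ _ (fP (x, y) Dx Dy)).
  by rewrite e; exact: (fP (x', y')).
Qed.

(** If [D] has a disjoint copy [h D], the pairing of [D] extends to the union of
    [D] and [h D]: the three new blocks of the square of this union are sent to
    [h D], using the pairing of [D] and tags built from two elements of [D]. *)
Lemma pairing_graph_extend G (D := square G) (h : K -> K) c0 c1 :
  pairing_graph G -> (forall x, D x -> ~ D (h x)) ->
  (forall x y, D x -> D y -> h x = h y -> x = y) ->
  D c0 -> D c1 -> c0 <> c1 ->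
  exists2 G', pairing_graph G' & G `<` G'.
Proof.
move=> GP hN hI Dc0 Dc1 c01; have [G1 G2 G3 G4] := GP.
have [f [fP fD fI]] := pairing_graph_fun GP (ex_intro _ c0 Dc0).
rewrite -/D in fP fD fI.
(* [e b x] runs through the union of [D] and [h D], and [b] tells the side. *)
pose e (b : bool) x := if b then h x else x.
pose c (b : bool) := if b then c1 else c0.
have cD b : D (c b) by case: b.
have cI b b' : c b = c b' -> b = b' by case: b b' => [] [] // /esym.
have eI b b' x x' : D x -> D x' -> e b x = e b' x' -> b = b' /\ x = x'.
  move=> Dx Dx'; case: b b' => [] [] //=.
  - by move=> /hI ->.
  - by move=> xx'; case: (hN x Dx); rewrite xx'.
  - by move=> xx'; case: (hN x' Dx'); rewrite -xx'.
pose g b b' x y := h (f (f (c b, c b'), f (x, y))).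
have gN b b' x y : D x -> D y -> ~ D (g b b' x y).
  by move=> Dx Dy; apply: (hN); do !apply: (fD).
have gI b1 b1' x1 y1 b2 b2' x2 y2 : D x1 -> D y1 -> D x2 -> D y2 ->
    g b1 b1' x1 y1 = g b2 b2' x2 y2 ->
    [/\ b1 = b2, b1' = b2', x1 = x2 & y1 = y2].
  move=> Dx1 Dy1 Dx2 Dy2.
  move=> /(hI _ _ (fD _ _ (fD _ _ (cD b1) (cD b1')) (fD _ _ Dx1 Dy1))
    (fD _ _ (fD _ _ (cD b2) (cD b2')) (fD _ _ Dx2 Dy2))).
  move=> /fI[]; [exact: fD..|].
  by move=> /fI[] // /cI-> /cI-> /fI[].
(* The block [b = b' = false] is the old square. *)
pose new b b' x y z := [/\ b || b', D x, D y & z = g b b' x y].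
pose G' := G `|` [set t | exists b b' x y, new b b' x y t.2 /\
  t.1 = (e b x, e b' y)].
have GG' : G `<=` G' by exact: subsetUl.
have sqE b x : D x -> square G' (e b x).
  move=> Dx; case: b; last exact: (squareS GG').
  by exists (g true true x x); right; exists true, true, x, x.
have sqG' x : square G' x -> exists b x', D x' /\ x = e b x'.
  move=> [z [Gx|]].
    by exists false, x; split=> //; exists z.
  by move=> [b [b' [x' [y' [[_ Dx Dy _] [-> _]]]]]]; exists b, x'.
(* A triple of [G] and a new triple differ both in value and in arguments. *)
have GnewF b b' x y x0 y0 z : G (x0, y0, z) -> new b b' x y z -> False.
  by move=> /G1[_ _ Dz] [_ Dx Dy ze]; apply: (gN b b' x y) => //; rewrite -ze.
have GnewA b b' x y x0 y0 z z' : G (x0, y0, z) -> new b b' x y z' ->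
    (x0, y0) = (e b x, e b' y) -> False.
  move=> /G1[Dx0 Dy0 _] [bb Dx Dy _] [xe ye].
  have [bF _] : false = b /\ x0 = x by apply: eI => //.
  have [b'F _] : false = b' /\ y0 = y by apply: eI => //.
  by move: bb; rewrite -bF -b'F.
exists G'; last first.
  split=> // /(_ (h c0, h c0, g true true c0 c0)) GF.
  have /G1[Dh _ _] : G (h c0, h c0, g true true c0 c0).
    by apply: GF; right; exists true, true, c0, c0.
  exact: (hN c0).
split.
- move=> x y z [/G1[Dx Dy Dz]|[b [b' [x' [y' [[bb Dx Dy /= ->] [-> ->]]]]]]].
    by split; exact: squareS GG' _ _.
  split; [exact: sqE..|].
  by apply: (sqE true); do !apply: (fD).
- move=> x y /sqG'[b [x' [Dx ->]]] /sqG'[b' [y' [Dy ->]]].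
  have [bb|] := boolP (b || b').
    by exists (g b b' x' y'); right; exists b, b', x', y'.
  rewrite negb_or => /andP[/negbTE-> /negbTE->].
  by exists (f (x', y')); left; exact: fP.
- move=> x y z z' [Gz|[b [b' [x1 [y1 /= [Nz ez]]]]]]
    [Gz'|[d [d' [x2 [y2 /= [Nz' ez']]]]]].
  + exact: G3 Gz Gz'.
  + by case: (GnewA _ _ _ _ _ _ _ _ Gz Nz' ez').
  + by case: (GnewA _ _ _ _ _ _ _ _ Gz' Nz ez).
  + move: Nz Nz' ez' => [_ Dx1 Dy1 ->] [_ Dx2 Dy2 ->]; rewrite ez.
    by move=> [/eI-/(_ Dx1 Dx2)[-> ->] /eI-/(_ Dy1 Dy2)[-> ->]].
- move=> x y x' y' z [Gz|[b [b' [x1 [y1 /= [Nz ez]]]]]]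
    [Gz'|[d [d' [x2 [y2 /= [Nz' ez']]]]]].
  + exact: G4 Gz Gz'.
  + by case: (GnewF _ _ _ _ _ _ _ Gz Nz').
  + by case: (GnewF _ _ _ _ _ _ _ Gz' Nz).
  + move: Nz Nz' ez ez' => [_ Dx1 Dy1 ->] [_ Dx2 Dy2 /gI].
    by move=> /(_ Dx1 Dy1 Dx2 Dy2)[-> -> -> ->] [-> ->] [-> ->].
Qed.

Lemma infinite_pairing : infinite_set [set: K] ->
  exists p : K * K -> K, injective p.
Proof.
move=> /infiniteP /card_le_fun_type[i iI].
pose G0 : set (K * K * K) :=
  [set t | exists m n, t = (i m, i n, i (pickle (m, n)))].
have sqG0 m : square G0 (i m) by exists (i (pickle (m, m))), m, m.
have G0P : pairing_graph G0.
  split.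
  - by move=> x y z [m [n [-> -> ->]]]; split; exact: sqG0.
  - move=> x y [z [m [m' [-> _ _]]]] [z' [n [n' [-> _ _]]]].
    by exists (i (pickle (m, n))), m, n.
  - move=> x y z z' [m [n [-> -> ->]]] [m' [n' [/iI<- /iI<- ->]]] //.
  - move=> x y x' y' z [m [n [-> -> ->]]] [m' [n' [-> -> /iI]]].
    by move=> /(pcan_inj pickleK)[-> ->].
(* Zorn's lemma is applied to the pairings extending [G0]. *)
have [M [MP maxM]] : exists M, pairing_graph (G0 `|` M) /\
    forall B, M `<` B -> ~ pairing_graph (G0 `|` B).
  apply: (@Zorn_bigcup _ (fun M => pairing_graph (G0 `|` M))) => F FP totF.
  have -> : G0 `|` \bigcup_(M in F) M =
      \bigcup_(G in [set G0] `|` [set G0 `|` M | M in F]) G.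
    rewrite bigcup_setU bigcup_set1 bigcup_image predeqE => t; split.
      by move=> [|[M FM Mt]]; [left|right; exists M => //; right].
    by move=> [|[M FM [|Mt]]]; [left|left|right; exists M].
  apply: pairing_graph_bigcup; first by exists G0; left.
    by move=> G [->//|[M FM <-]]; exact: FP.
  move=> G G' [->|[M FM <-]] [->|[M' FM' <-]].
  - by left.
  - by left; exact: subsetUl.
  - by right; exact: subsetUl.
  - by have [MM'|M'M] := totF _ _ FM FM'; [left|right]; exact: setUS.
set G := G0 `|` M in MP; pose D := square G.
have Di m : D (i m) by apply: squareS (sqG0 m); exact: subsetUl.
have i01 : i 0 <> i 1 by move=> /iI.
have [DK|] := pselect (~` D #<= D); last first.
  (* The complement of [D] contains a copy of [D], against maximality. *)
  move=> nDK; have /(card_le_fun (i 0))[h hD hI] : D #<= ~` D.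
    have := card_le_total (set_type D) (set_type (~` D)).
    rewrite (card_le_eql (card_setT _)) (card_le_eqr (card_setT _)).
    by rewrite (card_le_eql (card_setT _)) (card_le_eqr (card_setT _)) => -[].
  have [G' G'P GG'] := pairing_graph_extend MP hD hI (Di 0) (Di 1) i01.
  have G0G' : G0 `<=` G' by apply: subset_trans (proj1 GG'); exact: subsetUl.
  exfalso; apply: (maxM G'); last by rewrite setUidr.
  split; first by apply: subset_trans (proj1 GG'); exact: subsetUr.
  by move=> G'M; apply: (proj2 GG') => t /G'M; right.
have [f [fP fD fI]] := pairing_graph_fun MP (ex_intro _ _ (Di 0)).
rewrite -/D in fP fD fI.
(* Otherwise [K] itself embeds into [D], as two pieces of size at most [D]. *)
have [h hD hI] := card_le_fun (i 0) DK.
pose e x := if pselect (D x) then f (i 0, x) else f (i 1, h x).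
have eD x : D (e x).
  by rewrite /e; case: pselect => Dx; apply: fD => //; exact: hD.
have eI : injective e.
  move=> x y; rewrite /e; case: pselect => Dx; case: pselect => Dy.
  - by move=> /fI[].
  - by move=> /fI[] //; exact: hD.
  - by move=> /fI[] //; [exact: hD|move=> /esym].
  - move=> exy; apply: hI => //.
    by have [] // := fI _ _ _ _ _ _ _ _ exy; exact: hD.
exists (fun t => f (e t.1, e t.2)) => -[x y] [x' y'] /=.
by move=> /fI[]// /eI -> /eI ->.
Qed.
End Pairing.

(** * Closing off a set under operations of infinite arity *)

Lemma card_le_prod (A B K : Type) : infinite_set [set: K] ->
  [set: A] #<= [set: K] -> [set: B] #<= [set: K] -> [set: A * B] #<= [set: K].
Proof.
move=> /infinite_pairing[p pI] /card_le_fun_type[f fI] /card_le_fun_type[g gI].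
apply: (@card_leT_inj _ _ (fun t => p (f t.1, g t.2))) => -[a b] [a' b'] /=.
by move=> /pI[/fI-> /gI->].
Qed.

Lemma card_le_seq (A K : Type) : infinite_set [set: K] ->
  [set: A] #<= [set: K] -> [set: seq A] #<= [set: K].
Proof.
move=> Kinf /card_le_fun_type[f fI]; have [p pI] := infinite_pairing Kinf.
have /infiniteP/card_le_fun_type[i iI] := Kinf.
(* [c] is injective only on sequences of a given size, hence the first
   component of the code. *)
pose c := foldr (fun a k => p (f a, k)) (i 0).
apply: (@card_leT_inj _ _ (fun s => p (i (size s), c s))) => s t /pI[/iI].
elim: s t => [|a s IHs] [|b t] //= [st] /pI[/fI-> ct].
by rewrite (IHs t).
Qed.

Lemma card_le_powerset (K L : Type) :
  [set: K] #<= [set: L] -> [set: set K] #<= [set: set L].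
Proof.
move=> /card_le_fun_type[f fI]; apply: (@card_leT_inj _ _ (image^~ f)) => S T.
by move=> fST; apply/funext => k; rewrite -[LHS](image_inj fI) fST image_inj.
Qed.

(** Well-founded trees with nodes labelled in [L] and branching over [B]. *)
Inductive tree (L B : Type) : Type :=
  | Leaf
  | Node (l : L) (f : B -> tree L B).
Arguments Leaf {L B}.

(** The set of the pairs of a path from the root to a node and the label of that
    node. *)
Fixpoint tree_code (L B : Type) (t : tree L B) : set (seq B * L) :=
  if t is Node l f then
    fun p => if p.1 is b :: s then tree_code (f b) (s, p.2) else p.2 = l
  else set0.

Lemma tree_code_inj (L B : Type) : injective (@tree_code L B).
Proof.
elim=> [|l f IHf] [|m g] // fg.
- by have : tree_code (@Leaf L B) ([::], m) by rewrite fg.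
- by have : tree_code (@Leaf L B) ([::], l) by rewrite -fg.
- have -> : l = m.
    have : tree_code (Node l f) ([::], l) by [].
    by rewrite fg.
  congr Node; apply/funext => b; apply: IHf; apply/funext => -[s k].
  by have := congr1 (@^~ (b :: s, k)) fg.
Qed.

(** The smallest set containing [x0] and closed under the operations [op l]
    consists of the values of the trees, seen as terms. *)
Lemma card_le_closing_off (K L B X : Type) (op : L -> (B -> X) -> X) (x0 : X) :
  infinite_set [set: K] -> [set: L] #<= [set: K] -> [set: B] #<= [set: K] ->
  exists A : set X, [/\ A x0,
    forall l a, (forall b, A (a b)) -> A (op l a) & A #<= [set: set K]].
Proof.
move=> Kinf LK BK.
pose ev := fix ev (t : tree L B) : X :=
  if t is Node l f then op l (fun b => ev (f b)) else x0.
exists (range ev); split; first by exists Leaf.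
  move=> l a aA; have /choice[f fP] : forall b, exists t, ev t = a b.
    by move=> b; have [t _ <-] := aA b; exists t.
  by exists (Node l f) => //=; congr op; apply/funext.
apply: card_le_trans (card_image_le _ _) _.
apply: card_le_trans (card_leT_inj (@tree_code_inj L B)) _.
by apply: card_le_powerset; apply: card_le_prod LK => //; exact: card_le_seq.
Qed.

(** * The Hausdorff and Urysohn numbers *)

Lemma powerset_not_card_le (X : Type) : ~ ([set: set X] #<= [set: X]).
Proof.
move=> /card_le_fun_type[f fI].
pose D := [set x | exists2 S, f S = x & ~ S x].
have nD : ~ D (f D) by move=> DD; have [S /fI-> /(_ DD)] := DD.
by apply: (nD); exists D.
Qed.

(** The least cardinal in the definition of [hausdorff_number] and
    [urysohn_number] exists, since no subset of [X] has as many points as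
    [set X]. *)
Lemma card_min_forall_le (X : Type) (n : nat) (Q : set X -> Prop) :
  [set: card_min (fun K => forall A : set X, [set: K] #<= A -> Q A)] #<= `I_n
  <-> forall A : set X, `I_n #<= A -> Q A.
Proof.
pose P (K : Type) := forall A : set X, [set: K] #<= A -> Q A.
have [PK minK] : is_card_min P (card_min P).
  apply: card_minP; exists (set X) => A /card_le_trans-/(_ _ _ (card_leT A)).
  by move=> /powerset_not_card_le.
split=> [Kn A nA|Qn]; first by apply: PK; exact: card_le_trans Kn nA.
rewrite -(card_le_eqr (card_esym card_II)); apply: minK => A.
by rewrite (card_le_eql (card_esym card_II)); exact: Qn.
Qed.

Lemma n_hausdorffP (n : nat) (X : topologicalType) : n_hausdorff n X <->
  forall A : set X, `I_n #<= A ->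
    exists2 U : X -> set X, forall a, A a -> open_nbhs a (U a) &
      \bigcap_(a in A) U a = set0.
Proof. exact: card_min_forall_le. Qed.

Lemma n_urysohnP (n : nat) (X : topologicalType) : n_urysohn n X <->
  forall A : set X, `I_n #<= A ->
    exists2 U : X -> set X, forall a, A a -> open_nbhs a (U a) &
      \bigcap_(a in A) closure (U a) = set0.
Proof. exact: card_min_forall_le. Qed.

(** * One-point extensions and cluster points of open filters *)

Lemma card_le_setD1 (T : Type) (n : nat) (A : set T) (a : T) :
  `I_n.+1 #<= A -> `I_n #<= A `\ a.
Proof.
move=> /(card_le_fun a)[f fA fI].
have [i0 i0P] : exists i0, forall j, (j <= n)%N -> f j = a -> j = i0.
  have [[i iI fia]|nai] := pselect (exists2 i, (i <= n)%N & f i = a).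
    by exists i => j jn fja; apply: fI => //; rewrite fja.
  by exists 0 => j jn fja; case: nai; exists j.
have bn i : (i < n)%N -> (bump i0 i <= n)%N.
  by move=> lin; rewrite /bump; case: (i0 <= i)%N => //; exact: ltnW.
(* [bump i0] skips the only index that [f] may send to [a]. *)
apply: (@fun_card_le _ _ _ _ (f \o bump i0)).
  move=> i /= /bn bin; split; first exact: fA.
  by move=> /(i0P _ bin) e; have := neq_bump i0 i; rewrite e eqxx.
move=> i j /= /bn bi /bn bj fij.
exact: (can_inj (bumpK i0)) (fI _ _ bi bj fij).
Qed.

(** [X] with a point [None] added, whose neighbourhoods are to be the sets that
    contain it and an open member of [F]. The filter [F] is made part of the
    type so that the topology can be attached to it. *)
Definition point_ext (X : topologicalType) (F : set_system X) (FF : Filter F)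
  : Type := option X.

Section PointExt.
Variables (X : topologicalType) (F : set_system X) (FF : Filter F).
Local Notation Y := (point_ext FF).

HB.instance Definition _ := Choice.on Y.

(** The traces on [X] of open sets are open, and in [F] for those that contain
    the new point. *)
Definition point_ext_open : set_system Y :=
  [set W : set Y | open (Some @^-1` W : set X) /\ (W None -> F (Some @^-1` W))].

Lemma point_ext_openT : point_ext_open setT.
Proof.
by split=> [|_]; rewrite preimage_setT; [exact: openT|exact: filterT].
Qed.

Lemma point_ext_openI : setI_closed point_ext_open.
Proof.
move=> W W' [oW FW] [oW' FW']; split; rewrite preimage_setI; first exact: openI.
by move=> [/FW ? /FW' ?]; exact: filterI.
Qed.

Lemma point_ext_open_bigU (I : Type) (f : I -> set Y) :
  (forall i, point_ext_open (f i)) -> point_ext_open (\bigcup_i f i).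
Proof.
move=> fo; split; rewrite preimage_bigcup.
  by apply: bigcup_open => i _; have [] := fo i.
move=> [i _ fiN]; have [_ /(_ fiN)] := fo i.
by apply: filterS => x fix_; exists i.
Qed.

HB.instance Definition _ := isOpenTopological.Build Y
  point_ext_openT point_ext_openI point_ext_open_bigU.

Lemma point_ext_openE : @open Y = point_ext_open.
Proof. by []. Qed.

Lemma preimage_image_Some (U : set X) : Some @^-1` (Some @` U) = U.
Proof. by apply/seteqP; split=> [x [y Uy [<-]]|x Ux] //; exists x. Qed.

Lemma point_ext_open_Some (U : set X) : open U -> open (Some @` U : set Y).
Proof.
move=> oU; rewrite point_ext_openE; split; last by case.
by rewrite preimage_image_Some.
Qed.

End PointExt.

Lemma point_ext_embedding (X : topologicalType) (F : set_system X)
  (FF : Filter F) : embedding (Some : X -> point_ext FF).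
Proof.
split; first by move=> x y [].
apply/funext => U; apply/propext; split.
  move=> oU; exists (Some @` U); last exact: preimage_image_Some.
  exact: point_ext_open_Some.
by move=> [W + <-]; rewrite point_ext_openE => -[].
Qed.

(** Points of [X] only are separated as in [X]. The new point is separated from
    any point of [X] that is not a cluster point of [F], and there is one such
    point among any [n]. *)
Lemma point_ext_n_hausdorff (n : nat) (X : topologicalType) (F : set_system X)
    (FF : Filter F) :
  (forall A, F A -> exists2 U, open U /\ F U & U `<=` A) ->
  n_hausdorff n.+1 X -> ~ (`I_n #<= cluster F) ->
  n_hausdorff n.+1 (point_ext FF).
Proof.
move=> Fopen /n_hausdorffP nX nF; apply/n_hausdorffP => A IA.
pose A' : set X := Some @^-1` A.
have [AN|nAN] := pselect (A None); last first.
  have [|U UA' U0] := nX A'.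
    apply: card_le_trans IA _.
    have -> : A = Some @` A'.
      by apply/seteqP; split=> [[x|]|_ [x Ax <-]] //; exists x.
    exact: card_image_le.
  exists (fun y => if y is Some x then Some @` U x else setT).
    move=> [x|//] Ax; have [oU Ux] := UA' _ Ax.
    by split; [exact: point_ext_open_Some|exists x].
  apply/seteqP; split=> // -[x|] xU.
    suff : set0 x by [].
    rewrite -U0 => a Aa.
    by have [y Uy [<-]] := xU (Some a) Aa.
  have [[x|] Ax] : A !=set0.
    apply/set0P/eqP => A0; move: IA; rewrite A0 card_le0 => /eqP I0.
    suff : @set0 nat 0 by [].
    by rewrite -I0.
  - by have [] := xU _ Ax.
  - by case: nAN.
have [[x A'x nx]|clA] := pselect (exists2 x, A' x & ~ cluster F x); last first.
  case: nF; have : A' `<=` cluster F.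
    by move=> x A'x; apply: contrapT => nx; apply: clA; exists x.
  move=> /subset_card_le; apply: card_le_trans.
  apply: card_le_trans (card_le_setD1 None IA) _.
  apply: card_le_trans (card_image_le Some A').
  by apply: subset_card_le => -[x|] [Ax /= //] _; exists x.
move: nx; rewrite clusterEonbhs => nx.
have [G [N [FG Nx GN]]] : exists G N, [/\ F G, open_nbhs x N & G `&` N = set0].
  apply: contrapT => nGN; apply: nx => G N FG Nx; apply/set0P/eqP => GN.
  by apply: nGN; exists G, N.
have [W [oW FW] WG] := Fopen _ FG.
pose V : set (point_ext FF) := None |` (Some @` W).
have VS : Some @^-1` V = W.
  by apply/seteqP; split=> [y [//|[z Wz [<-]]]|y Wy] //; right; exists y.
have Vo : open V by rewrite point_ext_openE; split; rewrite VS.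
exists (fun y : point_ext FF => if y is Some z then
     (if z == x then Some @` N else setT) else V).
  move=> [z|] Az; last by split=> //; left.
  case: eqP => [->|_]; last by split=> //; exact: openT.
  by have [oN Nx'] := Nx; split; [exact: point_ext_open_Some|exists x].
apply/seteqP; split=> // y yU.
have := yU (Some x) A'x; rewrite /= eqxx => -[z Nz zy].
have := yU None AN => /=; rewrite -zy => -[//|[w Ww [wz]]].
suff : set0 z by [].
by rewrite -GN; split=> //; apply: WG; rewrite -wz.
Qed.

(** When [F] is proper, [None] is in the closure of [X]. *)
Lemma n_H_closed_cluster (n : nat) (X : topologicalType) (F : set_system X) :
  n_H_closed n.+1 X -> ProperFilter F ->
  (forall A, F A -> exists2 U, open U /\ F U & U `<=` A) ->
  `I_n #<= cluster F.
Proof.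
move=> [nX Xcl] FF Fopen; apply: contrapT => nF.
have fF : Filter F by exact: filter_filter.
have := Xcl _ _ (point_ext_n_hausdorff fF Fopen nX nF) (point_ext_embedding fF).
move=> /closed_openC; rewrite point_ext_openE => -[_ FN].
have : F (Some @^-1` (~` range (Some : X -> point_ext fF))) by apply: FN => -[].
suff -> : Some @^-1` (~` range Some) = set0 :> set X by exact: filter_not_empty.
by apply/seteqP; split=> // x; apply; exists x.
Qed.

(** * Covers and centered sets of points in n-H-closed spaces *)

Lemma open_seq_bigcap (I : eqType) (X : topologicalType) (s : seq I)
    (U : I -> set X) :
  (forall i, i \in s -> open (U i)) ->
  open [set y | forall i, i \in s -> U i y].
Proof.
elim: s => [|i s IHs] oU.
  have -> : [set y | forall i, i \in [::] -> U i y] = setT.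
    by apply/seteqP; split.
  exact: openT.
have -> : [set y | forall j, j \in i :: s -> U j y] =
    U i `&` [set y | forall j, j \in s -> U j y].
  apply/seteqP; split=> [y yU|y [yi ys] j].
    by split=> [|j js]; apply: yU; rewrite inE ?eqxx ?js ?orbT.
  by rewrite inE => /orP[/eqP->|] //; exact: ys.
apply: openI; first by apply: oU; rewrite mem_head.
by apply: IHs => j js; apply: oU; rewrite inE js orbT.
Qed.

Lemma card_le_seq_set (X : eqType) (s : seq X) : [set` s] #<= `I_(size s).
Proof.
apply: (@fun_card_le _ _ _ _ (index^~ s)) => [x|x y] /=; rewrite -index_mem //.
rewrite index_mem => xs ys e.
by rewrite -(nth_index x xs) e nth_index.
Qed.

Lemma n_H_closed_dense_finite (n : nat) (X : topologicalType) (T : set X)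
    (N : X -> set X) :
  n_H_closed n.+1 X -> ~ (`I_n #<= T) ->
  (forall x, ~ T x -> open_nbhs x (N x)) ->
  exists2 s : seq X, (forall x, x \in s -> ~ T x) &
    forall y, exists2 x, x \in s & closure (N x) y.
Proof.
move=> Xcl nT oN; apply: contrapT => nos.
(* [F] is generated by the complements of the closures of the [N x]. *)
pose E (s : seq X) : set X :=
  [set y | forall x, x \in s -> (~` closure (N x)) y].
pose F : set_system X :=
  [set G | exists2 s : seq X, (forall x, x \in s -> ~ T x) & E s `<=` G].
have FF : ProperFilter F.
  split.
    move=> [s sT sE]; apply: nos; exists s => // y; apply: contrapT => ny.
    by apply: (sE y) => x xs xy; apply: ny; exists x.
  split.
  - by exists [::].
  - move=> G G' [s sT sE] [s' sT' sE']; exists (s ++ s').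
      by move=> x; rewrite mem_cat => /orP[/sT|/sT'].
    move=> y yE; split; [apply: sE => x xs|apply: sE' => x xs];
      by apply: yE; rewrite mem_cat xs ?orbT.
  - by move=> G G' GG' [s sT sE]; exists s => //; exact: subset_trans GG'.
apply: nT; apply: card_le_trans (n_H_closed_cluster Xcl FF _) _.
  move=> G [s sT sE]; exists (E s) => //; split; last by exists s.
  by apply: open_seq_bigcap => x _; apply: closed_openC; exact: closed_closure.
apply: subset_card_le => x xF; apply: contrapT => nTx.
have FE : F (E [:: x]) by exists [:: x] => // z; rewrite inE => /eqP->.
have [y [yE yN]] := xF _ _ FE (open_nbhs_nbhs (oN x nTx)).
by apply: (yE x); [rewrite inE|exact: subset_closure].
Qed.

(** The points of [s] have no open neighbourhoods with empty intersection. *)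
Definition centered (X : topologicalType) (s : seq X) : Prop :=
  forall U : X -> set X, (forall a, a \in s -> open_nbhs a (U a)) ->
    exists y, forall a, a \in s -> U a y.

(** The intersections of open neighbourhoods of the points of [s] generate a
    filter with at least [n] cluster points, and any of them outside [s] can be
    added. *)
Lemma centered_cons (n : nat) (X : topologicalType) (s : seq X) :
  n_H_closed n.+1 X -> (size s < n)%N -> centered s ->
  exists2 x, x \notin s & centered (x :: s).
Proof.
move=> Xcl sn sC.
pose E (U : X -> set X) : set X := [set y | forall a, a \in s -> U a y].
pose F : set_system X := [set G | exists2 U : X -> set X,
  (forall a, a \in s -> open_nbhs a (U a)) & E U `<=` G].
have FF : ProperFilter F.
  split; first by move=> [U /sC[y yU] UG]; exact: (UG y).
  split.
  - by exists (fun=> setT) => // a _; split=> //; exact: openT.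
  - move=> G G' [U Us UG] [U' Us' UG']; exists (fun a => U a `&` U' a).
      move=> a sa; have [oU Ua] := Us a sa; have [oU' Ua'] := Us' a sa.
      by split; [exact: openI|].
    by move=> y yU; split; [apply: UG|apply: UG'] => a /yU[].
  - by move=> G G' GG' [U Us UG]; exists U => //; exact: subset_trans GG'.
have nF : `I_n #<= cluster F.
  apply: n_H_closed_cluster Xcl FF _ => G [U Us UG].
  exists (E U) => //; split; last by exists U.
  by apply: open_seq_bigcap => a /Us[].
have [x Fx xs] : exists2 x, cluster F x & x \notin s.
  apply: contrapT => nx; have Fs : cluster F `<=` [set` s].
    by move=> x Fx /=; apply/negPn/negP => xs; apply: nx; exists x.
  have := card_le_trans nF (subset_card_le Fs).
  move=> /card_le_trans-/(_ _ _ (card_le_seq_set s)).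
  by rewrite card_le_II leqNgt sn.
exists x => // U Us; have FU : F (E U).
  by exists U => // a sa; apply: Us; rewrite inE sa orbT.
have [y [yE yU]] := Fx _ _ FU (open_nbhs_nbhs (Us x (mem_head _ _))).
by exists y => a; rewrite inE => /orP[/eqP->//|]; exact: yE.
Qed.

Lemma centered_exists (n : nat) (X : topologicalType) (p : X) :
  n_H_closed n.+2 X ->
  exists s : seq X, [/\ uniq s, size s = n.+1, p \in s & centered s].
Proof.
move=> Xcl.
suff /(_ n (leqnn n)) : forall k, (k <= n)%N ->
  exists s : seq X, [/\ uniq s, size s = k.+1, p \in s & centered s] by [].
elim=> [_|k IHk kn].
  exists [:: p]; split=> //; first by rewrite inE.
  move=> U Up; exists p => a; rewrite inE => /eqP->.
  by have [] := Up p (mem_head _ _).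
have [s [us ss ps sC]] := IHk (ltnW kn).
have [|x xs xC] := centered_cons Xcl _ sC; first by rewrite ss.
by exists (x :: s); split; rewrite //= ?xs ?ss ?inE ?ps ?orbT.
Qed.

(** The condition on the families [V(., x)] in the definition of the n-Urysohn
    pseudocharacter. *)
Definition urysohn_pseudobase (n : nat) (X : topologicalType) (K : Type)
    (V : K -> X -> set X) : Prop :=
  (forall k x, open_nbhs x (V k x)) /\
  forall x : 'I_n -> X, injective x ->
    exists k : 'I_n -> K, \bigcap_i closure (V (k i) (x i)) = set0.

(** If the closures of the neighbourhoods chosen for [x] and for the points of
    [s] do not meet, then the one of [x] misses [p], for [p] lies in all the
    others: any neighbourhood of [p] meets the intersection of those of [s]. *)
Lemma urysohn_pseudobase_separation (n : nat) (X : topologicalType) (K : Type)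
    (V : K -> X -> set X) (s : seq X) (p x : X) :
  urysohn_pseudobase n.+1 V -> uniq s -> size s = n -> centered s ->
  p \in s -> x \notin s -> exists k, ~ closure (V k x) p.
Proof.
move=> [oV sV] us ss sC ps xs.
pose z (i : 'I_n.+1) := nth x (x :: s) i.
have [|k kV] := sV z.
  have sz : size (x :: s) = n.+1 by rewrite /= ss.
  move=> i j /eqP; rewrite nth_uniq ?sz ?ltn_ord//= ?xs ?us//.
  by move=> /eqP /val_inj.
exists (k ord0) => xp; suff : set0 p by [].
rewrite -kV => i _; case: (unliftP ord0 i) => [j ->|->] //.
move=> B /nbhs_interior Bp.
(* The index in [x :: s] of an element of [s] is its index in [s] plus one. *)
pose U a := V (k (inord (index a s).+1)) a `&`
  (if a == p then B° else setT).
have [|y yU] := sC U.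
  move=> a sa; apply: open_nbhsI; first exact: oV.
  case: eqP => [->|_]; last by split=> //; exact: openT.
  by split; [exact: open_interior|exact: nbhs_singleton].
exists y; split; last by have [_] := yU p ps; rewrite eqxx => /interior_subset.
have js : (j < size s)%N by rewrite ss.
have [+ _] := yU _ (mem_nth x js).
rewrite index_uniq// /z lift0 /=.
rewrite (_ : inord _ = lift ord0 j) //; apply: val_inj.
by rewrite /= inordK // ltnS; exact: (ltn_ord j).
Qed.

(** * The bound by the pseudocharacter *)

(** [x] is a limit of the family [a], in the sense that [a l] is in the closure
    of [V k x] for each [k] in [l]. The condition also ranges over [k0], the
    default value of [nth]. *)
Definition theta_point (X : topologicalType) (K : Type) (V : K -> X -> set X)
    (k0 : K) (a : seq K -> X) (x : X) : Prop :=
  forall l i, closure (V (nth k0 l i) x) (a l).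

(** There are fewer than [n] such limits: for [n] of them, the closures of
    neighbourhoods [V (k i) (x i)] would all contain [a l], where [l] lists the
    [k i]. *)
Lemma theta_points_seq (n : nat) (X : topologicalType) (K : Type)
    (V : K -> X -> set X) (k0 : K) (a : seq K -> X) :
  urysohn_pseudobase n V ->
  exists s : seq X, theta_point V k0 a = [set` s].
Proof.
move=> [_ sV]; apply/finite_seqP; apply: contrapT.
move=> /infiniteP /(card_le_fun (a [::]))[f fa fI].
have [k kV] := sV (fun i : 'I_n => f i) (fun i j e => val_inj (fI _ _ I I e)).
suff : set0 (a [seq k i | i <- enum 'I_n]) by [].
rewrite -kV => i _; have := fa i I [seq k i | i <- enum 'I_n] i.
by rewrite (nth_map i) ?size_enum_ord// nth_ord_enum.
Qed.

Lemma theta_point_exists (X : topologicalType) (K : Type) (V : K -> X -> set X)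
    (k0 : K) (A : set X) (x : X) :
  (forall l, exists2 y, A y &
     closure [set z | forall i, V (nth k0 l i) x z] y) ->
  exists2 a, (forall l, A (a l)) & theta_point V k0 a x.
Proof.
move=> Ax; have /choice[a aP] : forall l, exists y,
    A y /\ closure [set z | forall i, V (nth k0 l i) x z] y.
  by move=> l; have [y Ay yx] := Ax l; exists y.
exists a => [l|l i]; first by have [] := aP l.
have [_] := aP l.
by apply: closureS => z; apply.
Qed.

Lemma open_nbhs_nth (X : topologicalType) (K : Type) (V : K -> X -> set X)
    (k0 : K) (l : seq K) (x : X) :
  (forall k, open_nbhs x (V k x)) ->
  open_nbhs x [set z | forall i, V (nth k0 l i) x z].
Proof.
move=> oV; elim: l => [|k l IHl].
  suff -> : [set z | forall i, V (nth k0 [::] i) x z] = V k0 x by [].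
  by apply/seteqP; split=> [z /(_ 0)|z Vz i] //=; rewrite nth_nil.
suff -> : [set z | forall i, V (nth k0 (k :: l) i) x z] =
    V k x `&` [set z | forall i, V (nth k0 l i) x z].
  by have [oVk Vk] := oV k; have [oVl Vl] := IHl; split; [exact: openI|].
apply/seteqP; split=> [z zV|z [zk zV]].
  by split=> [|i]; [exact: (zV 0)|exact: (zV i.+1)].
by move=> [|i]; [exact: zk|exact: zV].
Qed.

(** The first bound, in terms of any family witnessing the pseudocharacter. *)
Lemma card_le_pseudobase (n : nat) (X : topologicalType) (K : Type)
    (V : K -> X -> set X) :
  n_H_closed n.+2 X -> infinite_set [set: K] -> urysohn_pseudobase n.+2 V ->
  [set: X] #<= [set: set K].
Proof.
move=> Xcl Kinf PV; have [oV _] := PV.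
have [x0|nX] := pselect (inhabited X); last first.
  by apply: (@card_leT_inj _ _ (fun=> set0)) => x; case: nX.
have {x0}[x0] := x0.
have /infinite_setN0[k0 _] := Kinf.
have /choice[e eP] := fun a => theta_points_seq k0 a PV.
(* A list of pairs [(k, x)] is presented by the list [l] of the first components
   and a family [a] whose value at [take i l], a sequence of size [i], is the
   second component of the pair of index [i]. *)
pose hit (l : seq K) (a : seq K -> X) : set X :=
  [set y | exists2 i, (i < size l)%N &
     closure (V (nth k0 l i) (a (take i l))) y].
have /choice[g gP] : forall la : seq K * (seq K -> X),
    exists y, (exists z, ~ hit la.1 la.2 z) -> ~ hit la.1 la.2 y.
  move=> [l a] /=; have [[z nz]|nz] := pselect (exists z, ~ hit l a z).
    by exists z.
  by exists x0 => /nz.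
(* For the operations of the first kind only the size of the label matters: it
   is the index of a limit of [a] in the list [e a]. *)
pose op (bl : bool * seq K) (a : seq K -> X) : X :=
  if bl.1 then nth x0 (e a) (size bl.2) else g (bl.2, a).
have seqK : [set: seq K] #<= [set: K] by apply: card_le_seq.
have boolK : [set: bool] #<= [set: K].
  have /infiniteP := Kinf; apply: card_le_trans.
  by apply: (@card_leT_inj _ _ nat_of_bool) => -[] [].
have [A [Ax0 opA Ale]] :=
  card_le_closing_off op x0 Kinf (card_le_prod Kinf boolK seqK) seqK.
suff AT : A = setT by rewrite -AT.
apply/seteqP; split=> // p _; apply: contrapT => nAp.
have farA x : ~ A x -> exists l, forall y, A y ->
    ~ closure [set z | forall i, V (nth k0 l i) x z] y.
  move=> nAx; apply: contrapT => nl.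
  have [|a aA ax] := @theta_point_exists X K V k0 A x.
    move=> l; apply: contrapT => ny; apply: nl; exists l => y Ay yc.
    by apply: ny; exists y.
  have : x \in e a by move: ax; rewrite eP.
  move=> xe; apply: nAx.
  have := opA (true, nseq (index x (e a)) k0) a aA.
  by rewrite /op /= size_nseq nth_index.
have [s [us ss ps sC]] := centered_exists p Xcl.
have near x : x \notin s -> exists k, ~ closure (V k x) p.
  exact: urysohn_pseudobase_separation PV us ss sC ps.
pose T := A `&` [set` s].
have nT : ~ (`I_n.+1 #<= T).
  move=> IT; have : `I_n.+1 #<= [set` rem p s].
    apply: card_le_trans IT (subset_card_le _) => x [Ax xs] /=.
    by rewrite mem_rem_uniq// inE xs andbT; apply: contra_notN nAp => /eqP<-.
  move=> /card_le_trans-/(_ _ _ (card_le_seq_set _)).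
  by rewrite size_rem// ss card_le_II ltnn.
have /choice[N NP] : forall x, exists N : set X, ~ T x ->
    [/\ open_nbhs x N,
        A x -> exists2 k, N = V k x & ~ closure (V k x) p &
        ~ A x -> forall y, A y -> ~ closure N y].
  move=> x; have [Tx|nTx] := pselect (T x); first by exists setT.
  have [Ax|nAx] := pselect (A x).
    have [|k kp] := near x; last by exists (V k x) => _; split=> // _; exists k.
    by apply/negP => xs; apply: nTx.
  have [l lA] := farA x nAx.
  exists [set z | forall i, V (nth k0 l i) x z] => _.
  by split=> //; exact: open_nbhs_nth.
have NT x : ~ T x -> open_nbhs x (N x) by move=> /NP[].
have [t tT tN] := n_H_closed_dense_finite Xcl nT NT.
have /choice[k kP] : forall x, exists k, x \in t -> A x ->
    N x = V k x /\ ~ closure (V k x) p.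
  move=> x; have [[xt Ax]|nx] := pselect (x \in t /\ A x); last first.
    by exists k0 => xt Ax; case: nx.
  by have [_ /(_ Ax)[k Nk kp] _] := NP x (tT x xt); exists k.
(* The chosen points of [A], presented as a list of pairs. *)
pose u := [seq x <- t | `[< A x >]].
pose l := map k u; pose a (r : seq K) := nth x0 u (size r).
have aA r : A (a r).
  rewrite /a; have [ru|ur] := ltnP (size r) (size u).
    by have := mem_nth x0 ru; rewrite mem_filter => /andP[/asboolP].
  by rewrite nth_default.
have hitE y : hit l a y <-> exists2 x, x \in u & closure (V (k x) x) y.
  have lE i : (i < size u)%N ->
      V (nth k0 l i) (a (take i l)) = V (k (nth x0 u i)) (nth x0 u i).
    by move=> iu; rewrite /a /l size_takel ?size_map ?(ltnW iu)// (nth_map x0).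
  split=> [[i]|[x xu yx]].
    rewrite size_map => iu; rewrite lE// => yi.
    by exists (nth x0 u i) => //; exact: mem_nth.
  have iu : (index x u < size u)%N by rewrite index_mem.
  by exists (index x u); rewrite ?size_map// lE// nth_index.
have nhit : ~ hit l a (g (l, a)).
  apply: (gP (l, a)); exists p => /hitE[x].
  rewrite mem_filter => /andP[/asboolP Ax xt].
  by have [] := kP x xt Ax.
(* [g (l, a)] is in [A] but outside the closures around the points of [u]. *)
have [x xt xN] := tN (g (l, a)).
have [Ax|nAx] := pselect (A x); last first.
  have [_ _ /(_ nAx) NA] := NP x (tT x xt).
  by case: (NA _ (opA (false, l) a aA)).
apply: nhit; apply/hitE; exists x.
  by rewrite mem_filter xt andbT; apply/asboolP.
by have [<-] := kP x xt Ax.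
Qed.

(** * The bound by the character *)

Lemma n_urysohn_pseudobase (n : nat) (X : topologicalType) (K : Type)
    (V : K -> X -> set X) :
  n_urysohn n X -> (forall k x, open_nbhs x (V k x)) ->
  (forall x U, nbhs x U -> exists k, V k x `<=` U) -> urysohn_pseudobase n V.
Proof.
move=> /n_urysohnP nX oV bV; split=> // x xI.
have xn : `I_n #<= range x.
  rewrite (card_le_eql card_II).
  by apply: (@fun_card_le _ _ _ _ x) => [i _|i j _ _ /xI//]; exists i.
have [U Ux U0] := nX _ xn.
have /choice[k kU] : forall i, exists k, V k (x i) `<=` U (x i).
  by move=> i; apply: bV; apply: open_nbhs_nbhs; apply: Ux; exists i.
exists k; apply/seteqP; split=> // y yV; rewrite -U0 => _ [i _ <-].
exact: closureS (kU i) _ (yV i I).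
Qed.

(** Each point has a local base of size at most the character; the values at the
    indices not used by it are filled with one of its members. *)
Lemma character_local_bases (X : topologicalType) :
  exists V : character X -> X -> set X, (forall k x, open_nbhs x (V k x)) /\
    forall x U, nbhs x U -> exists k, V k x `<=` U.
Proof.
pose P (K : Type) := forall x : X, [set: character_at x] #<= [set: K].
have [Pch _] : is_card_min P (card_min P).
  apply: card_minP; exists {x : X & character_at x} => x.
  apply: (@card_leT_inj _ _ (existT (@character_at X) x)) => a b.
  pose u : {x : X & character_at x} := existT _ x a.
  by move=> /(congr1 (fun v => tagged_as u v)); rewrite !tagged_asE.
pose V0P (x : X) (V0 : character X -> set X) :=
  (forall k, open_nbhs x (V0 k)) /\
  forall U, nbhs x U -> exists k, V0 k `<=` U.
have /choice[V VP] : forall x, exists V0, V0P x V0.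
  move=> x.
  have [[B [Bo Bb] Bx] _] : is_card_min
      (fun K => exists2 B, local_base x B & B #= [set: K]) (character_at x).
    apply: card_minP; exists (set_type (open_nbhs x)), (open_nbhs x).
      by split=> // U; rewrite nbhsE => -[W xW WU]; exists W.
    by rewrite card_eq_sym; exact: card_setT.
  have [N0 BN0 _] := Bb setT filterT.
  have BK : B #<= [set: card_min P] by rewrite (card_le_eql Bx); exact: Pch.
  have [l0] : inhabited (card_min P).
    have /card_leP[h] := BK.
    by constructor; exact: (set_val (h (SigSub (mem_set BN0)))).
  have [f _ fI] := card_le_fun l0 BK.
  have /choice[h hP] : forall l, exists N,
      B N /\ forall N', B N' -> f N' = l -> N = N'.
    move=> l; have [[N BN fN]|nN] := pselect (exists2 N, B N & f N = l).
      by exists N; split=> // N' BN' fN'; apply: fI => //; rewrite fN.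
    by exists N0; split=> // N' BN' fN'; case: nN; exists N'.
  exists (fun k => h k.1); split=> [k|U xU]; first by have [/Bo] := hP k.1.
  have [N BN NU] := Bb U xU.
  by exists (f N, 0); have [_ /(_ N BN erefl) ->] := hP (f N).
exists (fun k x => V x k).
by split=> [k x|x]; [exact: (VP x).1|exact: (VP x).2].
Qed.

Unset Implicit Arguments.
Theorem theorem4p18 (n : nat) (X : topologicalType) (hn : (2 <= n)%N)
  (hU : n_urysohn n X) (hH : n_H_closed n X) :
  [set: X] #<= [set: set (n_urysohn_pseudocharacter n X)] /\
  [set: X] #<= [set: set (character X)].
Proof.
have [[x0]|nX] := pselect (inhabited X); last first.
  by split; apply: (@card_leT_inj _ _ (fun=> set0)) => x; case: nX.
pose P (K : Type) := infinite_set [set: K] /\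
  exists V : K -> X -> set X, urysohn_pseudobase n V.
have [V [oV bV]] := character_local_bases X.
have Pchar : P (character X).
  split; last by exists V; exact: n_urysohn_pseudobase.
  have [[k0 _] _] := bV x0 setT filterT.
  by apply/infiniteP/(@card_leT_inj _ _ (pair k0)) => i j [].
have [[Kinf [W WP]] Kmin] : is_card_min P (n_urysohn_pseudocharacter n X).
  by apply: card_minP; exists (character X).
case: n hn hU hH P Pchar Kinf W WP Kmin
  => [|[|n]] // _ _ hH P Pchar Kinf W WP Kmin.
have le : [set: X] #<= [set: set (n_urysohn_pseudocharacter n.+2 X)].
  exact: card_le_pseudobase hH Kinf WP.
split=> //; apply: card_le_trans le _.
by apply: card_le_powerset; exact: Kmin.
Qed.
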